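(* Let $a,b\in\mathbb{N}$ with $b\geq 2$, $b\neq 3$, $(a,b)=1$ and $1\leq a\leq b-1$. Then $S(1,a,b)=-\frac{b}{2}$ if and only if there exists an integer $k$ with $0\leq k\leq b-2$ such that $3b=3a+k+1$.
   Context: $\mathbb{N}$ denotes the positive integers and $(a,b)$ the greatest common divisor. For $n,a,b\in\mathbb{N}$ with $b\geq 2$, define $$S(n,a,b):=\sum_{m=1}^{b-1}\cot\left(\frac{\pi m}{b}\right)\sin^{3}\left(2\pi mn\frac{a}{b}\right).$$ *)

(* Defs.v *)
From mathcomp Require Import all_boot all_order all_algebra.
From mathcomp Require Import reals trigo.

Set Implicit Arguments.
Unset Strict Implicit.
Unset Printing Implicit Defensive.

Import Order.TTheory GRing.Theory Num.Theory.
Local Open Scope ring_scope.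

Definition cot (R : realType) (x : R) : R := cos x / sin x.

Definition cot_sin3_sum (R : realType) (n a b : nat) : R :=
  \sum_(1 <= m < b)
    cot (pi * m%:R / b%:R) * sin (2 * pi * m%:R * n%:R * (a%:R / b%:R)) ^+ 3.

(* Main.v *)
Require Import Defs.
From mathcomp Require Import all_boot all_order all_algebra.
From mathcomp Require Import reals trigo.
From mathcomp Require Import ring lra zify.

Set Implicit Arguments.
Unset Strict Implicit.
Unset Printing Implicit Defensive.

Import Order.TTheory GRing.Theory Num.Theory.
Local Open Scope ring_scope.

(** Write [G r] for the sum over [1 <= m < b] of [cot (pi m / b) sin (2 pi m r / b)].
    Since [cot x (sin (2(r+1)x) - sin (2rx)) = cos (2(r+1)x) + cos (2rx)] and the
    cosines of the nontrivial multiples of [2 pi r / b] add up to [-1], one gets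
    Eisenstein's formula [G r = b - 2r] for [0 < r < b], and [G] has period [b].
    As [4 sin^3 x = 3 sin x - sin 3x], the sum in question is
    [(3 G a - G (3a)) / 4 = b (1 - q) / 2], where [q] is the quotient of [3a] by [b];
    the exclusion of [b = 3] guarantees that [b] does not divide [3a].  So the value
    [- b / 2] means [q = 2], that is [2b < 3a]. *)

Section TrigonometricSums.
Variable R : realType.
Implicit Types (x : R) (r b m : nat).

Lemma sin3E x : sin x ^+ 3 = (3 * sin x - sin (3 * x)) / 4.
Proof.
have -> : 3 * x = x + x + x by ring.
rewrite !sinD !cosD; have := cos2Dsin2 x; set s := sin x; set c := cos x => h.
have {}h : c ^+ 2 = 1 - s ^+ 2 by rewrite -h addrK.
have -> : (s * c + c * s) * c + (c * c - s * s) * s = 3 * s * c ^+ 2 - s ^+ 3.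
  by ring.
by rewrite h; field.
Qed.

Lemma sinD2pin x n : sin (x + 2 * pi * n%:R) = sin x.
Proof.
have -> : 2 * pi * n%:R = pi *+ 2 *+ n :> R.
  by rewrite -[RHS]mulr_natr -[pi *+ 2]mulr_natl.
exact: periodicn (@sinD2pi R) n x.
Qed.

Lemma sin_pi_frac_gt0 m b : (0 < m < b)%N -> 0 < sin (pi * m%:R / b%:R : R).
Proof.
move=> /andP[m0 mb]; have b0 : 0 < b%:R :> R by rewrite ltr0n (leq_trans _ mb).
apply: sin_gt0_pi; apply/andP; split.
  by rewrite divr_gt0 // mulr_gt0 ?pi_gt0 // ltr0n.
by rewrite ltr_pdivrMr // ltr_pM2l ?pi_gt0 // ltr_nat.
Qed.

(** With [y = pi r / b], multiplying by [2 sin y], nonzero since [0 < r < b], turns the terms into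
    differences of consecutive [sin ((2m - 1) y)]; the end values are [sin y] and [- sin y]. *)
Lemma sum_cos r b : (0 < r < b)%N ->
  \sum_(1 <= m < b) cos (2 * r%:R * (pi * m%:R / b%:R)) = -1 :> R.
Proof.
move=> rb; have s0 := sin_pi_frac_gt0 rb.
have b1 : (0 < b)%N by lia.
have b0 : b%:R != 0 :> R by rewrite pnatr_eq0; lia.
set y := pi * r%:R / b%:R in s0.
apply: (@mulfI _ (2 * sin y)); first by rewrite mulf_neq0 ?gt_eqF.
rewrite big_distrr /=.
rewrite (telescope_sumr_eq (fun m => sin ((2 * m%:R - 1) * y))) //.
  have -> : (2 * b%:R - 1) * y = - y + 2 * pi * r%:R by rewrite /y; field.
  have -> : (2 * 1%:R - 1) * y = y by ring.
  by rewrite sinD2pin sinN; ring.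
move=> m _.
have -> : 2 * r%:R * (pi * m%:R / b%:R) = 2 * m%:R * y by rewrite /y; ring.
have -> : (2 * m.+1%:R - 1) * y = 2 * m%:R * y + y by rewrite -natr1; ring.
have -> : (2 * m%:R - 1) * y = 2 * m%:R * y - y by ring.
by rewrite sinD sinB; ring.
Qed.

Definition cot_sin_sum b r : R :=
  \sum_(1 <= m < b) cot (pi * m%:R / b%:R) * sin (2 * r%:R * (pi * m%:R / b%:R)).

Lemma cot_sin_sum0 b : cot_sin_sum b 0 = 0.
Proof. by apply: big1 => m _; rewrite mulr0 mul0r sin0 mulr0. Qed.

Lemma cot_sin_sumDM b r q : (0 < b)%N ->
  cot_sin_sum b (r + q * b) = cot_sin_sum b r.
Proof.
move=> b0; apply: eq_bigr => m _; congr (_ * _).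
rewrite -[RHS](sinD2pin _ (q * m)); congr sin.
by rewrite natrD !natrM; field; rewrite pnatr_eq0; lia.
Qed.

Lemma cot_sin_sumS b r :
  cot_sin_sum b r.+1 - cot_sin_sum b r =
  \sum_(1 <= m < b) cos (2 * r.+1%:R * (pi * m%:R / b%:R)) +
  \sum_(1 <= m < b) cos (2 * r%:R * (pi * m%:R / b%:R)).
Proof.
rewrite /cot_sin_sum -sumrB -big_split /=; apply: eq_big_nat => m /sin_pi_frac_gt0.
set x := pi * _ / _ => s0.
have -> : 2 * r.+1%:R * x = 2 * r%:R * x + x + x by rewrite -natr1; ring.
set z := _ * x; rewrite /cot !(sinD, cosD).
have := cos2Dsin2 x; move: (sin z) (cos z) (cos x) (sin x) s0 => S C c s s0 h.
(* Inserting [c ^+ 2 + s ^+ 2] for a factor 1 makes both sides homogeneous in [c] and [s], so that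
   the identity becomes purely rational. *)
rewrite -[X in _ - _ * X]mulr1 -[X in _ = _ + X]mulr1 -h.
by field; rewrite gt_eqF.
Qed.

Lemma cot_sin_sumE b r : (0 < r < b)%N -> cot_sin_sum b r = b%:R - 2 * r%:R.
Proof.
elim: r => // r IHr rb; have := cot_sin_sumS b r; rewrite (sum_cos rb).
(* The step from 0 to 1 is special: at [r = 0] every cosine is 1, so the increment is [(b - 1) - 1];
   every later increment is [- 2]. *)
case: r => [|r] in IHr rb *.
  rewrite cot_sin_sum0 subr0 => ->.
  under eq_bigr do rewrite mulr0 mul0r cos0.
  by rewrite sumr_const_nat natrB; [ring|lia].
have rb' : (0 < r.+1 < b)%N by lia.
by rewrite (sum_cos rb') IHr // -[r.+2%:R]natr1; lra.
Qed.

Lemma cot_sin3_sumE a b :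
  cot_sin3_sum R 1 a b = (3 * cot_sin_sum b a - cot_sin_sum b (3 * a)) / 4.
Proof.
rewrite /cot_sin3_sum /cot_sin_sum big_distrr /= -sumrB big_distrl /=.
apply: eq_bigr => m _; rewrite sin3E.
have -> : 2 * pi * m%:R * 1 * (a%:R / b%:R) = 2 * a%:R * (pi * m%:R / b%:R) :> R.
  by ring.
have -> : 2 * (3 * a)%:R * (pi * m%:R / b%:R)
    = 3 * (2 * a%:R * (pi * m%:R / b%:R)) :> R by rewrite natrM; ring.
by ring.
Qed.

Lemma cot_sin3_sum_divn a b : (0 < a < b)%N -> ~~ (b %| 3 * a)%N ->
  cot_sin3_sum R 1 a b = b%:R * (1 - (3 * a %/ b)%:R) / 2.
Proof.
move=> ab ndvd; have b0 : (0 < b)%N by lia.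
have rb : (0 < 3 * a %% b < b)%N by rewrite ltn_mod b0 lt0n andbT.
rewrite cot_sin3_sumE {1}(divn_eq (3 * a) b) addnC cot_sin_sumDM // !cot_sin_sumE //.
have := congr1 (fun n => n%:R : R) (divn_eq (3 * a) b).
rewrite /= natrD !natrM.
move: (_ %/ _)%N (_ %% _)%N => q r E.
(* Once the remainder is eliminated, the terms in [a] cancel and only the quotient [q] survives. *)
have -> : r%:R = 3 * a%:R - q%:R * b%:R :> R by rewrite E; ring.
by field.
Qed.

End TrigonometricSums.

Theorem proposition1p7 (R : realType) (a b : nat)
    (hb2 : (2 <= b)%N) (hb3 : b <> 3%N) (hab : coprime a b)
    (ha : (1 <= a <= b - 1)%N) :
  cot_sin3_sum R 1 a b = - (b%:R / 2) <->
  exists k : int, 0 <= k <= b%:Z - 2 /\ 3 * b%:Z = 3 * a%:Z + k + 1.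
Proof.
have ndvd : ~~ (b %| 3 * a)%N.
  (* By coprimality [b] would divide 3, leaving only [b = 2], which fails. *)
  rewrite Gauss_dvdl 1?coprime_sym //; apply/negP => bdvd3.
  have b3 : (b <= 3)%N by apply: dvdn_leq bdvd3.
  have b2 : b = 2%N by lia.
  by rewrite b2 in bdvd3.
(* Quotient 2 gives only [2b <= 3a], while [k <= b - 2] amounts to [2b < 3a]; this excludes
   equality. *)
have n2 : (3 * a)%N <> (2 * b)%N.
  by move=> E; rewrite E dvdn_mull in ndvd.
have b0 : b%:R != 0 :> R by rewrite pnatr_eq0; lia.
rewrite cot_sin3_sum_divn //; last by lia.
have -> : b%:R * (1 - (3 * a %/ b)%:R) / 2 = - (b%:R / 2) :> R <->
    (3 * a %/ b)%N = 2%N.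
  split=> [E|->]; last by field.
  apply/eqP; rewrite -(eqr_nat R); apply/eqP; apply: (mulfI b0); lra.
split=> [E|[k [kb E]]].
  (* The equation forces this [k]; it is nonnegative because [a < b]. *)
  by exists (3 * b%:Z - 3 * a%:Z - 1); have := divn_eq (3 * a) b; rewrite E; lia.
by apply/eqP; rewrite eqn_leq -ltnS ltn_divLR ?leq_divRL; lia.
Qed.
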